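(* Let $p>1$ be a real number and let $\alpha\in\mathbb{R}$. Define, for $n\ge1$, $$\mu_\alpha(n)=\begin{cases} n^{\alpha-p} & \text{if }\alpha\neq p-1,\\ \mathbf{1}_{\{1\}}(n)+n^{-1}\log^{-p}(n)\,\mathbf{1}_{[2,\infty)}(n) & \text{if }\alpha=p-1.\end{cases}$$ Then there exists a constant $\mathcal{A}_\alpha>0$ such that for all $u\in H^1_0(\mathbb{N})$, $$\sum_{n=1}^\infty|u_n-u_{n-1}|^p\,n^\alpha\ge\mathcal{A}_\alpha\sum_{n=1}^\infty|u_n|^p\,\mu_\alpha(n).$$ Moreover, for $\alpha=p-1$, there exists no constant $\mathcal{A}>0$ such that for all $u\in H^1_0(\mathbb{N})$ $$\sum_{n=1}^\infty|u_n-u_{n-1}|^p\,n^{p-1}\ge\mathcal{A}\sum_{n=1}^\infty\frac{|u_n|^p}{n}.$$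
   Context: $H^1_0(\mathbb{N})$ denotes the space of finitely supported real sequences $u=(u_n)_{n\ge0}$ with $u_0=0$. $\mathbf{1}_E$ denotes the indicator function of $E$ (so in the case $\alpha=p-1$, $\mu_\alpha(1)=1$ and $\mu_\alpha(n)=\frac{1}{n\log^p n}$ for $n\ge2$). *)

(* Defs.v *)
From mathcomp Require Import all_boot all_order all_algebra.
From mathcomp Require Import all_classical all_reals all_analysis.

Set Implicit Arguments.
Unset Strict Implicit.
Unset Printing Implicit Defensive.

Import Order.TTheory GRing.Theory Num.Theory.
Import numFieldNormedType.Exports.

Local Open Scope classical_set_scope.
Local Open Scope ring_scope.

(* The space H^1_0(N) of finitely supported real sequences vanishing at 0. *)
Definition H10 (R : realType) : set (nat -> R) :=
  [set u | u 0%N = 0 /\ finite_set [set n | u n != 0]].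

(* Only the values at n >= 1 are used. *)
Definition mu (R : realType) (p alpha : R) (n : nat) : R :=
  if alpha == p - 1 then
    \1_[set 1%N] n + n%:R^-1 * ln n%:R `^ (- p) * \1_[set k : nat | (2 <= k)%N] n
  else n%:R `^ (alpha - p).

(* Main.v *)
Require Import Defs.
From mathcomp Require Import all_boot all_order all_algebra.
From mathcomp Require Import all_classical all_reals all_analysis.
From mathcomp Require Import ring lra zify.

(* Perspective convexity of |.|^p, applied with the midpoint of s < t, gives
     t^(1-p) |a|^p + k t^(-p) (t - s) |b|^p
       <= s^(1-p) |b|^p + ((t - s) / 2)^(1-p) |a - b|^p,   k = (p - 1) / (2 p).
   Along a positive monotone sequence whose n-th increment is at least
   c n^(- alpha / (p - 1)), the last coefficient is at most a constant times
   n^alpha, the outer terms telescope and the middle ones form the Hardy weight.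
   One takes n^r with r = (p - 1 - alpha) / (p - 1) when alpha < p - 1,
   (n + 1)^(- r) with r = (alpha - p + 1) / (p - 1) when alpha > p - 1, and
   log(n + 1) when alpha = p - 1.
   For the negative part, the trapezoid equal to 1 on [1, m] and decreasing
   linearly to 0 on [m, 2m] has energy at most 1 + 2^p, while its mass is at
   least the m-th harmonic number. *)

Set Implicit Arguments.
Unset Strict Implicit.
Unset Printing Implicit Defensive.

Import Order.TTheory GRing.Theory Num.Theory.
Import numFieldNormedType.Exports.

Local Open Scope classical_set_scope.
Local Open Scope ring_scope.

(** * Power inequalities and the one-step estimate *)

(** Each term is a value of the perspective [q (|z| / q)^p]; convexity of the power with weights
    [m / (m + k)] and [k / (m + k)] at [|x| / m] and [|y| / k] makes it subadditive. *)
Lemma powR_perspective (R : realType) (p m k x y : R) :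
  1 <= p -> 0 < m -> 0 < k ->
  `|x + y| `^ p * (m + k) `^ (1 - p) <=
  `|x| `^ p * m `^ (1 - p) + `|y| `^ p * k `^ (1 - p).
Proof.
move=> p1 m0 k0; have mk0 : 0 < m + k by rewrite addr_gt0.
have E z q : 0 < q -> `|z| `^ p * q `^ (1 - p) = q * (`|z| / q) `^ p.
  move=> q0; rewrite powRM ?invr_ge0 ?(ltW q0)// powRB ?(gt_eqF q0) ?implybT//.
  rewrite powRr1 ?(ltW q0)// -(powR_inv1 (ltW q0)) powRAC.
  by rewrite powR_inv1 ?powR_ge0// mulrCA.
rewrite !E//.
have l01 : 0 <= m / (m + k) <= 1.
  by rewrite divr_ge0 ?(ltW m0) ?(ltW mk0)//= ler_pdivrMr// mul1r lerDl ltW.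
have /andP[l0 l1] := l01.
have := @convex_powR R p p1 (Itv01 l0 l1) (`|x| / m) (`|y| / k).
rewrite !inE /= !in_itv /= !andbT !divr_ge0 ?(ltW m0) ?(ltW k0)// => /(_ isT isT).
rewrite [X in X `^ _ <= _]convRE [X in _ <= X]convRE /unstable.onem /= => cvx.
rewrite -ler_pdivlMl//.
apply: (@le_trans _ _ ((m / (m + k) * (`|x| / m) +
                        (1 - m / (m + k)) * (`|y| / k)) `^ p)).
  apply: ge0_ler_powR; rewrite ?nnegrE ?divr_ge0 ?(ltW mk0)//; first lra.
    by rewrite addr_ge0// mulr_ge0// ?divr_ge0 ?(ltW m0) ?(ltW k0)// subr_ge0.
  have -> : m / (m + k) * (`|x| / m) + (1 - m / (m + k)) * (`|y| / k) =
            (`|x| + `|y|) / (m + k).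
    by field; rewrite !gt_eqF.
  by rewrite ler_pM2r ?invr_gt0// ler_normD.
apply: (le_trans cvx); rewrite le_eqVlt; apply/orP; left; apply/eqP.
by field; rewrite gt_eqF.
Qed.

(** With [y = r (1 - x)], [x^r <= exp(- y) <= 1 / (1 + y)], and [1 - 1 / (1 + y) = y / (1 + y) >= y
    / (1 + r)] because [y <= r]. A single constant serves both [r < 1] and [r >= 1]. *)
Lemma powR_bernoulli (R : realType) (r x : R) :
  0 < r -> 0 <= x <= 1 -> r / (1 + r) * (1 - x) <= 1 - x `^ r.
Proof.
move=> r0 /andP[+ x1]; rewrite le_eqVlt => /predU1P[<-|x0].
  rewrite powR0 ?gt_eqF// subr0 mulr1 ler_pdivrMr; lra.
have /andP[y0 yr] : 0 <= r * (1 - x) <= r by nra.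
have xy : x `^ r <= expR (- (r * (1 - x))).
  rewrite /powR gt_eqF// ler_expR -mulrN ler_pM2l// opprB.
  by rewrite -{1}(subrKC 1 x) le_ln1Dx; lra.
have ey : expR (- (r * (1 - x))) <= (1 + r * (1 - x))^-1.
  by rewrite expRN lef_pV2 ?posrE ?expR_gt0 ?expR_ge1Dx; lra.
have : r / (1 + r) * (1 - x) <= 1 - (1 + r * (1 - x))^-1.
  rewrite -subr_ge0.
  have -> : 1 - (1 + r * (1 - x))^-1 - r / (1 + r) * (1 - x) =
     (r * (1 - x)) * (r * x) / ((1 + r * (1 - x)) * (1 + r)).
    by field; rewrite !gt_eqF//; lra.
  by rewrite divr_ge0// mulr_ge0//; nra.
lra.
Qed.

Lemma powR_le_opp (R : realType) (r x y : R) :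
  r <= 0 -> 0 < x -> x <= y -> y `^ r <= x `^ r.
Proof.
move=> r0 x0 xy; have y0 := lt_le_trans x0 xy.
rewrite -(opprK r) !(powRN _ (- r)) lef_pV2 ?posrE ?powR_gt0//.
by rewrite ge0_ler_powR ?nnegrE ?oppr_ge0 ?(ltW x0) ?(ltW y0).
Qed.

Lemma powR_div (R : realType) (x r : R) : 0 < x -> x `^ r / x = x `^ (r - 1).
Proof. by move=> x0; rewrite powRB ?(gt_eqF x0) ?implybT// powRr1 ?ltW. Qed.

(* For [s = 0] the power [s `^ (1 - p)] is [0], hence the side condition. *)
Lemma hardy_step (R : realType) (p s t a b : R) :
  1 < p -> 0 <= s < t -> (s = 0 -> b = 0) ->
  `|a| `^ p * t `^ (1 - p) +
    (p - 1) / (2 * p) * (`|b| `^ p * (t `^ (- p) * (t - s))) <=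
  `|b| `^ p * s `^ (1 - p) + `|a - b| `^ p * ((t - s) / 2) `^ (1 - p).
Proof.
move=> p1 /andP[+ st] sb; rewrite le_eqVlt => /predU1P[s0|s0].
  move: sb st; rewrite -s0 => sb st; rewrite sb// !subr0 normr0.
  rewrite (@powR0 _ p) ?gt_eqF//; last lra.
  rewrite !mul0r mulr0 addr0 add0r ler_wpM2l ?powR_ge0// powR_le_opp//; lra.
(* Splitting [t = m + (t - s) / 2] at the midpoint uses half of the increment for the [|a - b|]
   term; the other half, from [s] to [m], leaves the gap [s^(1-p) - m^(1-p)] that yields the Hardy
   term. *)
set m := (s + t) / 2; have m0 : 0 < m by rewrite /m; lra.
have t0 : 0 < t by lra.
have k0 : 0 < (t - s) / 2 by lra.
have /(_ b (a - b)) := powR_perspective _ _ (ltW p1) m0 k0.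
rewrite (_ : m + _ = t); last by rewrite /m; field.
rewrite subrKC => h1.
suff : (p - 1) / (2 * p) * (t `^ (- p) * (t - s)) <= s `^ (1 - p) - m `^ (1 - p).
  move=> /(ler_wpM2l (powR_ge0 `|b| p)); rewrite mulrBr mulrCA; lra.
have x01 : 0 <= s / m <= 1.
  rewrite divr_ge0 ?(ltW s0) ?(ltW m0)//= ler_pdivrMr// mul1r /m; lra.
have q0 : 0 < p - 1 by lra.
have := powR_bernoulli q0 x01.
rewrite powRM ?invr_ge0 ?(ltW s0) ?(ltW m0)//.
rewrite -(powR_inv1 (ltW m0)) -(powRrM m) mulN1r opprB.
move=> /(ler_wpM2l (powR_ge0 s (1 - p))).
have -> : s `^ (1 - p) * (1 - s `^ (p - 1) * m `^ (1 - p)) =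
          s `^ (1 - p) - m `^ (1 - p).
  rewrite mulrBr mulr1 mulrA -powRD; last by rewrite (gt_eqF s0) implybT.
  by rewrite (_ : 1 - p + (p - 1) = 0) ?powRr0 ?mul1r//; ring.
apply: le_trans.
rewrite powR_inv1 ?(ltW m0)//.
have -> : s `^ (1 - p) * ((p - 1) / (1 + (p - 1)) * (1 - s / m)) =
   (p - 1) / (2 * p) * ((s `^ (1 - p) / m) * (t - s)).
  by rewrite /m; field; rewrite !gt_eqF//; lra.
rewrite ler_wpM2l//; first by rewrite divr_ge0; lra.
rewrite ler_wpM2r//; first lra.
(* Since [s] and [m] are at most [t], [s^(1-p) / m >= t^(1-p) / t]. *)
have -> : t `^ (- p) = t `^ (1 - p) / t by rewrite powR_div// addrAC subrr add0r.
apply: ler_pM; rewrite ?powR_ge0 ?invr_ge0 ?(ltW t0)//.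
  by apply: powR_le_opp => //; lra.
by rewrite lef_pV2 ?posrE// /m; lra.
Qed.

(** * Telescoping along monotone sequences *)

Lemma hardy_sum_increasing (R : realType) (p : R) (H u : nat -> R) (N : nat) :
  1 < p -> H 0%N = 0 -> (forall n, H n < H n.+1) -> u 0%N = 0 ->
  (p - 1) / (2 * p) *
    \sum_(0 <= n < N) `|u n| `^ p * (H n.+1 `^ (- p) * (H n.+1 - H n)) <=
  \sum_(0 <= n < N) `|u n.+1 - u n| `^ p * ((H n.+1 - H n) / 2) `^ (1 - p).
Proof.
move=> p1 H0 Hlt u0.
have Hinc := homo_ltn lt_trans Hlt.
(* The induction carries the telescoping boundary term, which is nonnegative and dropped at the
   end. *)
suff : \sum_(0 <= n < N) `|u n.+1 - u n| `^ p * ((H n.+1 - H n) / 2) `^ (1 - p) -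
  (p - 1) / (2 * p) *
    \sum_(0 <= n < N) `|u n| `^ p * (H n.+1 `^ (- p) * (H n.+1 - H n)) >=
  `|u N| `^ p * H N `^ (1 - p).
  by move=> h; rewrite -subr_ge0; apply: le_trans h; rewrite mulr_ge0 ?powR_ge0.
elim: N => [|N IH].
  by rewrite !big_geq// mulr0 subr0 u0 normr0 powR0 ?mul0r// gt_eqF; lra.
rewrite !big_nat_recr//= mulrDr.
have HN : 0 <= H N < H N.+1.
  by rewrite Hlt andbT -H0; case: N {IH} => // N; rewrite ltW// Hinc.
have HN0 : H N = 0 -> u N = 0.
  by case: N {IH HN} => // N /eqP; rewrite -H0 gt_eqF// Hinc.
have := hardy_step (u N.+1) p1 HN HN0; lra.
Qed.

(** Here [hardy_step] is applied with [a = u N] and [b = u N.+1], so the boundary term lands on the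
    right; it disappears once [u N = 0]. *)
Lemma hardy_sum_decreasing (R : realType) (p : R) (G u : nat -> R) (N : nat) :
  1 < p -> (forall n, 0 < G n) -> (forall n, G n.+1 < G n) -> u 0%N = 0 ->
  (p - 1) / (2 * p) *
    \sum_(0 <= n < N) `|u n.+1| `^ p * (G n `^ (- p) * (G n - G n.+1)) <=
  \sum_(0 <= n < N) `|u n.+1 - u n| `^ p * ((G n - G n.+1) / 2) `^ (1 - p) +
  `|u N| `^ p * G N `^ (1 - p).
Proof.
move=> p1 G0 Glt u0; elim: N => [|N IH].
  by rewrite !big_geq// mulr0 u0 normr0 powR0 ?mul0r ?addr0// gt_eqF; lra.
rewrite !big_nat_recr//= mulrDr.
have GN : 0 <= G N.+1 < G N by rewrite Glt ltW.
have GN0 : G N.+1 = 0 -> u N.+1 = 0 by move/eqP; rewrite gt_eqF.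
have := hardy_step (u N) p1 GN GN0; rewrite distrC; lra.
Qed.

(** * Passage to series and general Hardy criteria *)

Lemma nneseries_eventually0 (R : realType) (f : nat -> R) (N : nat) :
  (forall n, 0 <= f n) -> (forall n, (N < n)%N -> f n = 0) ->
  (\sum_(1 <= n <oo) (f n)%:E)%E = (\sum_(0 <= n < N) f n.+1)%:E.
Proof.
move=> f0 fN; rewrite (nneseries_split _ N); last by move=> n _; rewrite lee_fin.
rewrite eseries0; last by move=> n Nn _; rewrite fN.
by rewrite adde0 sumEFin add1n big_add1.
Qed.

Lemma H10_eventually0 (R : realType) (u : nat -> R) :
  H10 u -> exists N, forall n, (N <= n)%N -> u n = 0.
Proof.
move=> [_ /finite_seqP[s us]]; exists (\max_(i <- s) i).+1 => n Nn.
apply/eqP/negPn/negP => un0.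
have : [set` s] n by rewrite -us.
by move=> /= ns; move: Nn; rewrite ltnNge (@leq_bigmax_seq _ s xpredT id n ns isT).
Qed.

Lemma hardy_series (R : realType) (p A : R) (mu w : nat -> R) :
  0 < p -> (forall n, 0 <= mu n) -> (forall n, 0 <= w n) ->
  (forall (u : nat -> R) N, u 0%N = 0 -> u N = 0 ->
    A * \sum_(0 <= n < N) `|u n.+1| `^ p * mu n.+1 <=
    \sum_(0 <= n < N) `|u n.+1 - u n| `^ p * w n.+1) ->
  forall u : nat -> R, H10 u ->
  (A%:E * (\sum_(1 <= n <oo) (`|u n| `^ p * mu n)%:E)
     <= \sum_(1 <= n <oo) (`|u n - u n.-1| `^ p * w n)%:E)%E.
Proof.
move=> p0 mu0 w0 hA u Hu; have [N uN] := H10_eventually0 Hu.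
have z0 : `|0 : R| `^ p = 0 by rewrite normr0 powR0// gt_eqF.
rewrite (@nneseries_eventually0 _ _ N); last 2 first.
- by move=> n; rewrite mulr_ge0 ?powR_ge0.
- by move=> n /ltnW Nn; rewrite uN// z0 mul0r.
rewrite (@nneseries_eventually0 _ _ N); last 2 first.
- by move=> n; rewrite mulr_ge0 ?powR_ge0.
- by move=> [//|n] Nn; rewrite !uN ?subr0 ?z0 ?mul0r// ltnW.
by rewrite -EFinM lee_fin; apply: hA; [case: Hu|exact: uN].
Qed.

(** The exponent [- alpha / (p - 1)] is the one that the negative power [1 - p] turns into [alpha],
    so a lower bound on an increment becomes an upper bound by the energy weight. *)
Lemma powR_opp_weight (R : realType) (p alpha c x h : R) :
  1 < p -> 0 < c -> 0 < x -> c * x `^ (- (alpha / (p - 1))) <= h ->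
  (h / 2) `^ (1 - p) <= (c / 2) `^ (1 - p) * x `^ alpha.
Proof.
move=> p1 c0 x0 ch.
have xa : x `^ alpha = (x `^ (- (alpha / (p - 1)))) `^ (1 - p).
  by rewrite -powRrM; congr (_ `^ _); field; lra.
rewrite xa -powRM ?powR_ge0//; last lra.
have y0 := powR_gt0 (- (alpha / (p - 1))) x0.
apply: powR_le_opp; [lra| |]; nra.
Qed.

Lemma hardy_increasing (R : realType) (p alpha c d : R) (H mu : nat -> R) :
  1 < p -> 0 < c -> 0 < d -> (forall n, 0 <= mu n) -> H 0%N = 0 ->
  (forall n, c * n.+1%:R `^ (- (alpha / (p - 1))) <= H n.+1 - H n) ->
  (forall n, d * mu n.+1 <= H n.+2 `^ (- p) * (H n.+2 - H n.+1)) ->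
  exists A : R, 0 < A /\ forall u : nat -> R, H10 u ->
    (A%:E * (\sum_(1 <= n <oo) (`|u n| `^ p * mu n)%:E)
       <= \sum_(1 <= n <oo) (`|u n - u n.-1| `^ p * n%:R `^ alpha)%:E)%E.
Proof.
move=> p1 c0 d0 mu0 H0 Hc Hd.
set C := (c / 2) `^ (1 - p); have C0 : 0 < C by rewrite powR_gt0// divr_gt0.
set k := (p - 1) / (2 * p); have k0 : 0 < k by rewrite divr_gt0; lra.
have Hlt n : H n < H n.+1.
  rewrite -subr_gt0; apply: lt_le_trans (Hc n).
  by rewrite mulr_gt0 ?powR_gt0 ?ltr0n.
exists (k * d / C); split; first by apply: divr_gt0 => //; exact: mulr_gt0.
have p0 : 0 < p by lra.
apply: hardy_series => // u N u0 uN.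
rewrite mulrAC ler_pdivrMr//.
have := hardy_sum_increasing N p1 H0 Hlt u0; rewrite -/k.
set S := \sum_(0 <= n < N) _ => hS.
have {}hS : k * (d * \sum_(0 <= n < N) `|u n.+1| `^ p * mu n.+1) <= k * S.
  rewrite ler_pM2l//.
  (* Index shift: the term at [N] is added and the term at [0] removed, both being zero. Thus
     [u n.+1] is paired with [H n.+2]. *)
  have -> : S = \sum_(0 <= n < N.+1) `|u n| `^ p * (H n.+1 `^ (- p) * (H n.+1 - H n)).
    by rewrite big_nat_recr//= uN normr0 powR0 ?mul0r ?addr0// gt_eqF; lra.
  rewrite big_nat_recl//= u0 normr0 powR0 ?mul0r ?add0r; last by rewrite gt_eqF; lra.
  rewrite mulr_sumr ler_sum// => n _.
  by rewrite mulrCA ler_wpM2l ?powR_ge0.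
rewrite -mulrA; apply: le_trans hS _.
apply: (le_trans (hardy_sum_increasing N p1 H0 Hlt u0)).
rewrite mulr_suml ler_sum// => n _.
by rewrite -mulrA ler_wpM2l ?powR_ge0// [leRHS]mulrC powR_opp_weight ?ltr0n.
Qed.

Lemma hardy_decreasing (R : realType) (p alpha c d : R) (G mu : nat -> R) :
  1 < p -> 0 < c -> 0 < d -> (forall n, 0 <= mu n) -> (forall n, 0 < G n) ->
  (forall n, c * n.+1%:R `^ (- (alpha / (p - 1))) <= G n - G n.+1) ->
  (forall n, d * mu n.+1 <= G n `^ (- p) * (G n - G n.+1)) ->
  exists A : R, 0 < A /\ forall u : nat -> R, H10 u ->
    (A%:E * (\sum_(1 <= n <oo) (`|u n| `^ p * mu n)%:E)
       <= \sum_(1 <= n <oo) (`|u n - u n.-1| `^ p * n%:R `^ alpha)%:E)%E.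
Proof.
move=> p1 c0 d0 mu0 G0 Gc Gd.
set C := (c / 2) `^ (1 - p); have C0 : 0 < C by rewrite powR_gt0// divr_gt0.
set k := (p - 1) / (2 * p); have k0 : 0 < k by rewrite divr_gt0; lra.
have Glt n : G n.+1 < G n.
  rewrite -subr_gt0; apply: lt_le_trans (Gc n).
  by rewrite mulr_gt0 ?powR_gt0 ?ltr0n.
exists (k * d / C); split; first by apply: divr_gt0 => //; exact: mulr_gt0.
have p0 : 0 < p by lra.
apply: hardy_series => // u N u0 uN.
rewrite mulrAC ler_pdivrMr//.
have := hardy_sum_decreasing N p1 G0 Glt u0.
rewrite -/k uN normr0 powR0 ?mul0r ?addr0; last by rewrite gt_eqF; lra.
move=> hS; apply: le_trans (le_trans _ hS) _.
  rewrite -mulrA ler_wpM2l ?(ltW k0)// mulr_sumr ler_sum// => n _.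
  by rewrite mulrCA ler_wpM2l ?powR_ge0.
rewrite mulr_suml ler_sum// => n _.
by rewrite -mulrA ler_wpM2l ?powR_ge0// [leRHS]mulrC powR_opp_weight ?ltr0n.
Qed.

(** * Choice of the sequence in the three regimes of [alpha] *)

Lemma powR_diff_ge (R : realType) (r s t : R) :
  0 < r -> 0 <= s <= t -> 0 < t ->
  r / (1 + r) * (t `^ (r - 1) * (t - s)) <= t `^ r - s `^ r.
Proof.
move=> r0 /andP[s0 st] t0.
have x01 : 0 <= s / t <= 1 by rewrite divr_ge0 ?(ltW t0)//= ler_pdivrMr// mul1r.
have := powR_bernoulli r0 x01 => /(ler_wpM2l (powR_ge0 t r)).
have -> : t `^ r * (1 - (s / t) `^ r) = t `^ r - s `^ r.
  by rewrite mulrBr mulr1 -powRM ?(ltW t0) ?(andP x01).1// mulrCA divff ?mulr1// gt_eqF.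
apply: le_trans.
by rewrite -powR_div// le_eqVlt; apply/orP; left; apply/eqP; field; rewrite !gt_eqF; lra.
Qed.

Lemma ln_diff_ge (R : realType) (s t : R) :
  0 < s -> 0 < t -> (t - s) / t <= ln t - ln s.
Proof.
move=> s0 t0; have x0 : 0 < s / t by rewrite divr_gt0.
have : ln (1 + (s / t - 1)) <= s / t - 1 by apply: le_ln1Dx; lra.
rewrite subrKC ln_div ?posrE// mulrBl divff ?gt_eqF//; lra.
Qed.

(** [n^r] has the growth of the partial sums of [n^(- alpha / (p - 1))], which diverge in this
    regime. *)
Lemma hardy_subcritical (R : realType) (p alpha : R) :
  1 < p -> alpha < p - 1 ->
  exists A : R, 0 < A /\ forall u : nat -> R, H10 u ->
    (A%:E * (\sum_(1 <= n <oo) (`|u n| `^ p * n%:R `^ (alpha - p))%:E)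
       <= \sum_(1 <= n <oo) (`|u n - u n.-1| `^ p * n%:R `^ alpha)%:E)%E.
Proof.
move=> p1 ap; set r := (p - 1 - alpha) / (p - 1).
have r0 : 0 < r by rewrite divr_gt0; lra.
set k := r / (1 + r); have k0 : 0 < k by rewrite divr_gt0; lra.
have Hdiff n : k * n.+1%:R `^ (r - 1) <= n.+1%:R `^ r - n%:R `^ r :> R.
  have := @powR_diff_ge R r n%:R n.+1%:R r0.
  by rewrite ler0n ler_nat leqnSn ltr0n -natrB// subSnn mulr1 => /(_ isT isT).
apply: (@hardy_increasing _ p alpha k (k * 2 `^ (alpha - p)) (fun n => n%:R `^ r)) => //.
- by rewrite mulr_gt0 ?powR_gt0.
- by rewrite powR0// gt_eqF.
- move=> n; rewrite (_ : - (alpha / (p - 1)) = r - 1); first exact: Hdiff.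
  by rewrite /r; field; lra.
move=> n; apply: le_trans (ler_wpM2l (powR_ge0 _ _) (Hdiff n.+1)).
rewrite -powRrM mulrCA -powRD; last by rewrite pnatr_eq0 implybT.
rewrite -mulrA ler_wpM2l ?(ltW k0)// -powRM ?ler0n//.
have -> : r * - p + (r - 1) = alpha - p by rewrite /r; field; lra.
(* The factor [2^(alpha - p)] pays for the index shift: [n + 2 <= 2 (n + 1)] and [alpha - p < 0]. *)
apply: powR_le_opp; [lra|by rewrite ltr0n|].
by rewrite -natrM ler_nat mul2n -addnn addnS addSn !ltnS leq_addr.
Qed.

(** The sums of [n^(- alpha / (p - 1))] now converge, and [n^(- r)] has the decay of their tails. *)
Lemma hardy_supercritical (R : realType) (p alpha : R) :
  1 < p -> p - 1 < alpha ->
  exists A : R, 0 < A /\ forall u : nat -> R, H10 u ->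
    (A%:E * (\sum_(1 <= n <oo) (`|u n| `^ p * n%:R `^ (alpha - p))%:E)
       <= \sum_(1 <= n <oo) (`|u n - u n.-1| `^ p * n%:R `^ alpha)%:E)%E.
Proof.
move=> p1 ap; set r := (alpha - (p - 1)) / (p - 1).
have r0 : 0 < r by rewrite divr_gt0; lra.
(* The factor [1 / 2] absorbs [x + 1 <= 2 x] for [x = n + 1]. *)
set k := r / (1 + r) / 2; have k0 : 0 < k by rewrite !divr_gt0//; lra.
have Gdiff n : k * n.+1%:R `^ (- r - 1) <= n.+1%:R `^ (- r) - n.+2%:R `^ (- r) :> R.
  have x0 : 0 < n.+1%:R :> R by rewrite ltr0n.
  have -> : n.+2%:R = n.+1%:R + 1 :> R by rewrite -natr1.
  have : 1 <= n.+1%:R :> R by rewrite ler1n.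
  move: (n.+1%:R) x0 => x x0 x1; have x2 : 0 < x + 1 by lra.
  have q01 : 0 <= x / (x + 1) <= 1.
    by rewrite divr_ge0//= ?ler_pdivrMr//; lra.
  have /(ler_wpM2l (powR_ge0 x (- r))) := powR_bernoulli r0 q01.
  have -> : x `^ (- r) * (1 - (x / (x + 1)) `^ r) = x `^ (- r) - (x + 1) `^ (- r).
    rewrite powRM ?invr_ge0 ?(ltW x0) ?(ltW x2)//.
    rewrite -(powR_inv1 (ltW x2)) -powRrM mulN1r.
    rewrite mulrBr mulr1 mulrA -powRD ?addNr ?powRr0 ?mul1r//.
    by rewrite eqxx gt_eqF.
  apply: le_trans; rewrite -powR_div//.
  have -> : x `^ (- r) * (r / (1 + r) * (1 - x / (x + 1))) =
      r / (1 + r) * (x `^ (- r) * (x + 1)^-1).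
    by field; rewrite !gt_eqF//; lra.
  have -> : k * (x `^ (- r) / x) = r / (1 + r) * (x `^ (- r) * (2 * x)^-1).
    by rewrite /k; field; rewrite !gt_eqF//; lra.
  rewrite ler_wpM2l//; first by rewrite divr_ge0; lra.
  by rewrite ler_wpM2l ?powR_ge0// lef_pV2 ?posrE; lra.
apply: (@hardy_decreasing _ p alpha k k (fun n => n.+1%:R `^ (- r))) => //.
- move=> n; rewrite (_ : - (alpha / (p - 1)) = - r - 1); first exact: Gdiff.
  by rewrite /r; field; lra.
move=> n; apply: le_trans (ler_wpM2l (powR_ge0 _ _) (Gdiff n)).
(* Both sides are powers of the same [n + 1], so the sign of [alpha - p] does not matter. *)
rewrite -powRrM mulrCA -powRD; last by rewrite pnatr_eq0 implybT.
rewrite (_ : - r * - p + (- r - 1) = alpha - p)//.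
by rewrite /r; field; lra.
Qed.

Lemma hardy_critical (R : realType) (p : R) :
  1 < p ->
  exists A : R, 0 < A /\ forall u : nat -> R, H10 u ->
    (A%:E * (\sum_(1 <= n <oo) (`|u n| `^ p * mu p (p - 1) n)%:E)
       <= \sum_(1 <= n <oo) (`|u n - u n.-1| `^ p * n%:R `^ (p - 1))%:E)%E.
Proof.
move=> p1.
have Hdiff n : n.+2%:R^-1 <= ln n.+2%:R - ln n.+1%:R :> R.
  have := @ln_diff_ge R n.+1%:R n.+2%:R; rewrite !ltr0n -natrB// subSnn mul1r.
  exact.
have mu1 : mu p (p - 1) 1%N = 1.
  rewrite /mu eqxx !indicE mem_set// memNset ?mulr0 ?addr0//.
have muS n : mu p (p - 1) n.+2 = n.+2%:R^-1 * ln n.+2%:R `^ (- p).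
  by rewrite /mu eqxx !indicE memNset// mem_set//= add0r mulr1.
(* [2^-1] comes from [n + 2 <= 2 (n + 1)]. The other constant comes from [ln 3 <= 2] at index 1, and
   at [n + 2] from [n + 4 <= 3 (n + 2)] and [n + 4 <= (n + 2)^2], which bounds [ln (n + 4)] by
   [2 ln (n + 2)]. *)
apply: (@hardy_increasing _ p (p - 1) 2^-1 (3^-1 * 2 `^ (- p)) (fun n => ln n.+1%:R)) => //.
- move=> n; rewrite /mu eqxx; rewrite addr_ge0 ?mulr_ge0 ?invr_ge0 ?powR_ge0 ?indicE ?ler0n//.
- exact: ln1.
- move=> n; rewrite divff; last by rewrite gt_eqF; lra.
  apply: le_trans (Hdiff n); rewrite powR_inv1 ?ler0n//.
  rewrite -invfM lef_pV2 ?posrE ?mulr_gt0 ?ltr0n//.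
  by rewrite -natrM ler_nat mul2n -addnn addnS addSn !ltnS leq_addr.
move=> n; apply: le_trans (ler_wpM2l (powR_ge0 _ _) (Hdiff n.+1)).
case: n => [|n].
  rewrite mu1 mulr1 mulrC ler_wpM2r ?invr_ge0 ?ler0n//.
  apply: powR_le_opp; [lra|by rewrite ln_gt0// ltr1n|].
  by rewrite (_ : 3%:R = 1 + 2 :> R)// ?le_ln1Dx; lra.
rewrite muS mulrACA -invfM mulrC ler_pM ?mulr_ge0 ?invr_ge0 ?mulr_ge0 ?powR_ge0 ?ler0n//.
  rewrite -powRM ?ln_ge0// ?ler1n//.
  have l2 : 0 < ln n.+2%:R :> R by rewrite ln_gt0// ltr1n.
  apply: powR_le_opp; [lra|by rewrite ln_gt0// ltr1n|].
  rewrite mulr_natl -lnXn ?ltr0n// ler_ln ?posrE ?exprn_gt0 ?ltr0n//.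
  by rewrite -natrX ler_nat; lia.
by rewrite lef_pV2 ?posrE ?mulr_gt0 ?ltr0n// -natrM ler_nat; lia.
Qed.

(** * Failure of the weight [1 / n] for [alpha = p - 1] *)

(** Truncated subtraction gives 0 from [2m] on; the Boolean factor forces 0 at [n = 0], where the
    quotient is 1 for positive [m]. *)
Definition trapezoid (R : realType) (m n : nat) : R :=
  (n != 0%N)%:R * ((minn m (m.*2 - n))%:R / m%:R).

Lemma trapezoid_plateau (R : realType) (m n : nat) :
  (0 < n <= m)%N -> trapezoid R m n = 1.
Proof.
move=> /andP[n0 nm]; rewrite /trapezoid -lt0n n0 mul1r.
have -> : minn m (m.*2 - n) = m by lia.
by rewrite divff// pnatr_eq0; lia.
Qed.

Lemma trapezoid_eq0 (R : realType) (m n : nat) :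
  (m.*2 <= n)%N -> trapezoid R m n = 0.
Proof.
move=> mn; rewrite /trapezoid (_ : minn m (m.*2 - n) = 0%N) ?mul0r ?mulr0//.
by lia.
Qed.

Lemma trapezoid_step (R : realType) (m n : nat) :
  (0 < n)%N -> `|trapezoid R m n.+1 - trapezoid R m n| <= m%:R^-1.
Proof.
move=> n0; rewrite /trapezoid -[n != 0%N]lt0n n0 !mul1r -mulrBl normrM normfV normr_nat.
rewrite ler_piMl ?invr_ge0//.
have [->|->] : minn m (m.*2 - n) = minn m (m.*2 - n.+1) \/
    minn m (m.*2 - n) = (minn m (m.*2 - n.+1)).+1 by lia.
  by rewrite subrr normr0.
by rewrite -natr1 opprD addrA subrr add0r normrN normr1.
Qed.

Lemma trapezoid_H10 (R : realType) (m : nat) : H10 (trapezoid R m).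
Proof.
split; first by rewrite /trapezoid mul0r.
apply: (sub_finite_set _ (finite_II m.*2)) => n /=.
by rewrite ltnNge; apply: contraNN => /(trapezoid_eq0 R) ->.
Qed.

Lemma trapezoid_energy (R : realType) (p : R) (m : nat) : 1 < p -> (0 < m)%N ->
  (\sum_(1 <= n <oo)
     (`|trapezoid R m n - trapezoid R m n.-1| `^ p * n%:R `^ (p - 1))%:E
   <= (1 + 2 `^ p)%:E)%E.
Proof.
move=> p1 m0; have p0 : 0 < p by lra.
rewrite (@nneseries_eventually0 _ _ m.*2); last 2 first.
- by move=> n; rewrite mulr_ge0.
- move=> n mn; have [mn1 mn2] : (m.*2 <= n /\ m.*2 <= n.-1)%N by lia.
  by rewrite !trapezoid_eq0// subrr normr0 powR0 ?mul0r// gt_eqF.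
rewrite lee_fin /=.
have m0' : 0 < m%:R :> R by rewrite ltr0n.
(* The jump at 1 costs 1. Every later term is at most [B], by a step of at most [1 / m] and a weight
   of at most [(2m)^(p-1)], and [2m] copies of [B] add up to [2^p]. *)
pose B : R := m%:R^-1 `^ p * m.*2%:R `^ (p - 1).
have m2E : m.*2 = m.*2.-1.+1 by lia.
rewrite m2E big_nat_recl//= trapezoid_plateau ?m0//.
rewrite {1}/trapezoid mul0r subr0 normr1 !powR1 mulr1 lerD2l.
apply: (@le_trans _ _ (\sum_(0 <= n < m.*2.-1) B)).
  rewrite big_nat_cond [leRHS]big_nat_cond; apply: ler_sum => n; rewrite andbT => /= nm.
  apply: ler_pM => //.
    by apply: ge0_ler_powR; rewrite ?nnegrE ?invr_ge0 ?(ltW p0) ?trapezoid_step.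
  apply: ge0_ler_powR; rewrite ?nnegrE ?ler_nat; [lra|by []|by []|lia].
rewrite sumr_const_nat subn0.
apply: (@le_trans _ _ (m.*2%:R * B)).
  by rewrite -[leLHS]mulr_natl ler_wpM2r ?mulr_ge0// ler_nat leq_pred.
rewrite /B mulrCA mulr_powRB1 ?ler0n// -powRM ?invr_ge0 ?ler0n//.
by rewrite -muln2 natrM mulrA mulVf ?mul1r// gt_eqF.
Qed.

Lemma harmonic_unbounded (R : realType) (B : R) : exists n, B < series harmonic n.
Proof.
apply: contrapT => /forallNP hB; apply: (@dvg_harmonic R).
apply: nondecreasing_is_cvgn.
  by apply: nondecreasing_series => n _ _; exact: harmonic_ge0.
by exists B => _ [n _ <-]; rewrite leNgt; apply/negP.
Qed.

Theorem corollary2p4 (R : realType) (p : R) (hp : 1 < p) :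
  (forall alpha : R, exists A : R, 0 < A /\
     forall u : nat -> R, H10 u ->
       (A%:E * (\sum_(1 <= n <oo) (`|u n| `^ p * mu p alpha n)%:E)
          <= \sum_(1 <= n <oo) (`|u n - u n.-1| `^ p * n%:R `^ alpha)%:E)%E)
  /\
  ~ (exists A : R, 0 < A /\
       forall u : nat -> R, H10 u ->
         (A%:E * (\sum_(1 <= n <oo) (`|u n| `^ p / n%:R)%:E)
            <= \sum_(1 <= n <oo) (`|u n - u n.-1| `^ p * n%:R `^ (p - 1))%:E)%E).
Proof.
split=> [alpha|[A [A0 hA]]].
  have [ap|ap|->] := ltgtP alpha (p - 1); last exact: hardy_critical.
  - by rewrite /mu lt_eqF//; exact: hardy_subcritical.
  - by rewrite /mu gt_eqF//; exact: hardy_supercritical.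
have [m] := harmonic_unbounded ((1 + 2 `^ p) / A).
(* The contradiction is that [A] times any harmonic partial sum is at most the trapezoid energy
   bound. *)
apply/negP; rewrite -leNgt ler_pdivlMr// mulrC.
case: m => [|m]; first by rewrite /series /= big_geq// mulr0 addr_ge0.
rewrite -lee_fin; apply: le_trans (trapezoid_energy hp (ltn0Sn m)).
apply: le_trans (hA _ (trapezoid_H10 R m.+1)).
rewrite EFinM lee_wpmul2l ?lee_fin ?(ltW A0)//.
(* Only the plateau indices 1 to [m + 1] are kept; there the summand is [1 / n]. *)
apply: le_trans (nneseries_lim_ge m.+2 _); last first.
  by move=> n _ _; rewrite lee_fin mulr_ge0 ?invr_ge0.
rewrite sumEFin lee_fin big_add1 /series /= le_eqVlt; apply/orP; left; apply/eqP.
rewrite big_nat_cond [RHS]big_nat_cond; apply: eq_bigr => n; rewrite andbT => /= nm.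
by rewrite trapezoid_plateau// normr1 powR1 mul1r.
Qed.
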